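(* Let $d\geq 2$ and let $S$ be a special Danielewski surface over the affine line with $d$ origins, given by data $(n;\sigma_1,\ldots,\sigma_d)$, with distinguished regular function $u\in\mathbb{C}[S]$ and special fiber components $\ell_1,\ldots,\ell_d\subset S$ (see context). Let $P\in\mathbb{C}[Z]$ be a polynomial of degree $d$ whose roots $r_1,\ldots,r_d\in\mathbb{C}$ are all simple, and let $W\subset\mathbb{A}^3$ be the hypersurface defined by the equation $XY=P(Z)$. Suppose that $f\in\mathbb{C}[S]$ is a regular function such that $$f|_{\ell_i}=r_i\quad\text{for all }1\leq i\leq d,$$ and that $g(x,t)\in\mathbb{C}[x,t]$ is a polynomial such that $$g(x,r_i+xt)\equiv\sigma_i(x)\pmod{x^n}\ \text{ in }\mathbb{C}[x,t]\quad\text{for all }1\leq i\leq d.$$ Let $\mathbb{C}[W\times\mathbb{A}^1]=\mathbb{C}[x,y,z,w]$ with $xy=P(z)$ (that is, the quotient of the polynomial ring in four variables by the ideal generated by $XY-P(Z)$, with $x,y,z,w$ the classes of the variables), and let $\mathbb{C}[S\times\mathbb{A}^1]=\mathbb{C}[S][\alpha]$ be the polynomial ring in one variable $\alpha$ over $\mathbb{C}[S]$. Then the map $$\Phi\colon\mathbb{C}[W\times\mathbb{A}^1]\to\mathbb{C}[S\times\mathbb{A}^1]=\mathbb{C}[S][\alpha]$$ defined by $$\Phi(x)=x,\qquad \Phi(z)=f+x\alpha,\qquad \Phi(y)=\frac{P(f+x\alpha)}{x},\qquad \Phi(w)=\frac{u-g(x,f+x\alpha)}{x^n}$$ is an isomorphism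 (of $\mathbb{C}$-algebras; in particular the right-hand sides are elements of $\mathbb{C}[S][\alpha]$).
   Context: All varieties are over $\mathbb{C}$. A special Danielewski surface over the affine line with $d\geq2$ origins (equivalently, a Danielewski surface that is a principal $(\mathbb{C},+)$-bundle over this line) is constructed from the data of an integer $n\geq1$ and distinct polynomials $\sigma_1(x),\ldots,\sigma_d(x)\in\mathbb{C}[x]$, each of degree strictly smaller than $n$, as follows: $S$ is the surface obtained by gluing $d$ copies $\mathcal{U}_i=\mathrm{Spec}(\mathbb{C}[x,u_i])$, $1\leq i\leq d$, of $\mathbb{A}^2$ along the open subsets $\mathcal{U}_i^*=\mathrm{Spec}(\mathbb{C}[x,x^{-1},u_i])$ by means of the transition functions $$\mathcal{U}_i^*\to\mathcal{U}_j^*,\qquad (x,u_i)\mapsto\Big(x,\,u_i+\frac{\sigma_i(x)-\sigma_j(x)}{x^n}\Big).$$ Every such surface is affine, and $x$ is a regular function on it. The inclusion $\mathbb{C}[x]\hookrightarrow\mathbb{C}[S]$ defines an $\mathbb{A}^1$-fibration $\pi\colon S\to\mathbb{A}^1$ whose unique special fiber is $\pi^{-1}(0)=\coprod_{i=1}^d\ell_i$, where $\ell_i=\{x=0\}\subset\mathcal{U}_i$ is isomorphic to $\mathbb{A}^1$. The regular function $u\in\mathbb{C}[S]$ is defined by $u|_{\mathcal{U}_i}=x^nu_i+\sigma_i(x)\in\mathbb{C}[x,u_i]$ for all $1\leq i\leq d$. *)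

(* Defs.v *)
From HB Require Import structures.
From mathcomp Require Import all_boot all_order all_algebra.
From mathcomp Require Import generic_quotient ring_quotient.
From mathcomp Require Import boolp mpoly.

Set Implicit Arguments.
Unset Strict Implicit.
Unset Printing Implicit Defensive.

Import GRing.Theory.
Local Open Scope ring_scope.

(* [degree < pole] is [size <= pole], the zero polynomial being allowed.      *)
Record danielewski_data (K : fieldType) := DanielewskiData {
  origins : nat;
  pole : nat;
  sigma : 'I_origins -> {poly K};
  origins_gt1 : (1 < origins)%N;
  pole_gt0 : (0 < pole)%N;
  sigma_inj : injective sigma;
  size_sigma : forall i, (size (sigma i) <= pole)%N
}.

Arguments sigma {K} d i.

Fact affine_glue (R : comNzRingType) (F : fieldType) (phi : {rmorphism R -> F})
    (a b c : R) :
  phi a != 0 ->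
  map_poly phi (a%:P * 'X + b%:P) =
  map_poly phi (a%:P * 'X + c%:P) \Po ('X + (phi (b - c) / phi a)%:P).
Proof.
have mapE y : map_poly phi (a%:P * 'X + y%:P) = (phi a)%:P * 'X + (phi y)%:P.
  by rewrite rmorphD rmorphM /= !map_polyC map_polyX.
move=> a0; rewrite !mapE comp_polyD comp_polyM !comp_polyC comp_polyX.
rewrite mulrDr -polyCM mulrCA divff // mulr1 -addrA -polyCD.
by rewrite rmorphB subrK.
Qed.

Section RegularFunctions.

Variables (K : fieldType) (D : danielewski_data K).

Local Notation n := (pole D).
Local Notation sigma := (sigma D).

(* A bivariate polynomial ring K[x, t] is {poly {poly K}}: the inner variable *)
(* 'X%:P is x, the outer variable 'X is t.  An element of atlas has one       *)
(* component in K[x, u_i] for each chart U_i.                                 *)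
Local Notation atlas := {ffun 'I_(origins D) -> {poly {poly K}}}.

(* K[x, 1/x, u] is embedded in K(x)[u]. *)
Definition to_overlap : {poly {poly K}} -> {poly {fraction {poly K}}} :=
  map_poly (@tofrac {poly K}).

Definition transition (i j : 'I_(origins D)) : {poly {fraction {poly K}}} :=
  'X + (tofrac (sigma i - sigma j) / tofrac 'X^n)%:P.

(* f_i (x, u_i) = f_j (x, u_i + (sigma_i - sigma_j) / x^n) on U_i^* for all   *)
(* i and j: the f_i glue to a function on the surface.                        *)
Definition glues : pred atlas := fun f =>
  [forall i, forall j,
    to_overlap (f i) == to_overlap (f j) \Po transition i j].

Lemma gluesP (f : atlas) :
  reflect (forall i j, to_overlap (f i) = to_overlap (f j) \Po transition i j)
          (f \in glues).
Proof.
apply: (iffP forallP) => [H i j|H i]; first by apply/eqP/(forallP (H i)).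
by apply/forallP => j; apply/eqP.
Qed.

Lemma glues_subring : subring_closed glues.
Proof.
split=> [|f g /gluesP Hf /gluesP Hg|f g /gluesP Hf /gluesP Hg];
  apply/gluesP => i j; rewrite !ffunE /to_overlap.
- by rewrite rmorph1 comp_polyC.
- by rewrite !rmorphB /= -!/(to_overlap _) (Hf i j) (Hg i j).
- by rewrite !rmorphM /= -!/(to_overlap _) (Hf i j) (Hg i j).
Qed.

(* The coordinate ring K[S]: the global sections of the structure sheaf of    *)
(* the glued surface S, as a subring of the product of the K[x, u_i].         *)
Record coord_ring := CoordRing {
  section_of : atlas;
  section_glues : section_of \in glues
}.

HB.instance Definition _ := [isSub for section_of].
HB.instance Definition _ := [Choice of coord_ring by <:].
HB.instance Definition _ := GRing.SubChoice_isSubPzRing.Build atlas glues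
  coord_ring glues_subring.

Lemma coord_mulC : commutative (@GRing.mul coord_ring).
Proof.
by move=> f g; apply/val_inj/ffunP => i; rewrite !rmorphM /= !ffunE mulrC.
Qed.

HB.instance Definition _ :=
  GRing.PzRing_hasCommutativeMul.Build coord_ring coord_mulC.

Lemma coord_oner_neq0 : 1 != 0 :> coord_ring.
Proof.
apply/eqP => /(congr1 (fun f : coord_ring =>
  val f (Ordinal (ltnW (origins_gt1 D))))).
by rewrite rmorph1 rmorph0 !ffunE => /eqP; rewrite oner_eq0.
Qed.

HB.instance Definition _ :=
  GRing.PzSemiRing_isNonZero.Build coord_ring coord_oner_neq0.

Lemma base_glues (a : {poly K}) : [ffun _ => a%:P] \in glues.
Proof.
by apply/gluesP => i j; rewrite !ffunE /to_overlap map_polyC comp_polyC.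
Qed.

(* The inclusion of K[x] in K[S], dual to the A^1-fibration. *)
Definition base (a : {poly K}) : coord_ring := CoordRing (base_glues a).

Lemma base_is_zmod_morphism : zmod_morphism base.
Proof.
by move=> a b; apply/val_inj/ffunP => i; rewrite rmorphB !ffunE /= polyCB.
Qed.
Lemma base_is_monoid_morphism : monoid_morphism base.
Proof.
split=> [|a b]; apply/val_inj/ffunP => i.
  by rewrite rmorph1 !ffunE.
by rewrite rmorphM !ffunE /= polyCM.
Qed.
HB.instance Definition _ :=
  GRing.isZmodMorphism.Build {poly K} coord_ring base base_is_zmod_morphism.
HB.instance Definition _ :=
  GRing.isMonoidMorphism.Build {poly K} coord_ring base
    base_is_monoid_morphism.

Definition fun_x : coord_ring := base 'X.

Lemma u_glues : [ffun i => ('X^n)%:P * 'X + (sigma i)%:P] \in glues.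
Proof.
apply/gluesP => i j; rewrite !ffunE; apply: affine_glue.
by rewrite tofrac_eq0 monic_neq0 ?monicXn.
Qed.

Definition fun_u : coord_ring := CoordRing u_glues.

(* The restriction of f to the line l_i = {x = 0} of U_i, in K[u_i]. *)
Definition restrict_line (i : 'I_(origins D)) (f : coord_ring) : {poly K} :=
  map_poly (fun a : {poly K} => a.[0]) (section_of f i).

(* K[S x A^1] = K[S][alpha] is {poly coord_ring}, with alpha = 'X; it is a    *)
(* K-algebra through cstS.                                                    *)
Definition cstS (c : K) : {poly coord_ring} := (base c%:P)%:P.

Definition eval1 (p : {poly K}) (F : {poly coord_ring}) : {poly coord_ring} :=
  (map_poly cstS p).[F].

(* g (x, F) for g in K[x, t] and F in K[S][alpha]. *)
Definition eval2 (g : {poly {poly K}}) (F : {poly coord_ring}) :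
    {poly coord_ring} :=
  (map_poly (fun a => (base a)%:P) g).[F].

End RegularFunctions.

Section CoordinateRingW.

Variables (K : fieldType) (P : {poly K}).

Local Notation A4 := {mpoly K[4]}.

Definition varX : A4 := 'X_(@Ordinal 4 0 isT).
Definition varY : A4 := 'X_(@Ordinal 4 1 isT).
Definition varZ : A4 := 'X_(@Ordinal 4 2 isT).
Definition varW : A4 := 'X_(@Ordinal 4 3 isT).

Definition eqnW : A4 := varX * varY - (map_poly (@mpolyC 4 K) P).[varZ].

Definition idealW (p : A4) : bool := `[< exists q, p = q * eqnW >].

(* The ideal is proper because eqnW vanishes at the point (1, P(0), 0, 0). *)
Lemma idealW_closed : idealr_closed idealW.
Proof.
split.
- by apply/asboolP; exists 0; rewrite mul0r.
- apply/negP => /asboolP[q].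
  pose v (i : 'I_4) : K :=
    if val i == 0%N then 1 else if val i == 1%N then P.[0] else 0.
  move=> /(congr1 (meval v)).
  rewrite rmorph1 rmorphM /eqnW rmorphB rmorphM /= !mevalXU.
  rewrite -horner_map /= mevalXU /= -map_poly_comp.
  rewrite (eq_map_poly (g := id)); last by move=> c /=; rewrite mevalC.
  by rewrite map_poly_id // mul1r subrr mulr0 => /eqP; rewrite oner_eq0.
- move=> a p q /asboolP[p' ->] /asboolP[q' ->].
  by apply/asboolP; exists (a * p' + q'); rewrite mulrDl mulrA.
Qed.

HB.instance Definition _ := isIdealr.Build A4 idealW idealW_closed.

(* K[W x A^1] = K[X, Y, Z, W] / (XY - P(Z)), a K-algebra through cstW. *)
Definition coordW := {ideal_quot (idealW : idealr A4)}.

HB.instance Definition _ := GRing.ComNzRing.on coordW.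
HB.instance Definition _ := Quotient.on coordW.

Definition classW (p : A4) : coordW := \pi_coordW%qT p.

Definition cstW (c : K) : coordW := classW (mpolyC 4 c).

End CoordinateRingW.

(* q is the quotient a / b: the one and only solution of b * q = a. *)
Definition is_quotient (A : pzRingType) (a b q : A) : Prop :=
  forall q', b * q' = a <-> q' = q.

(* Main.v *)
(* Let [A = K[W x A^1]] and [B = K[S][alpha]].  Divisibility by [x^n] in [B] can
   be tested in the charts, where [f = r_i + x h_i], so that [P(F)] and
   [u - g(x, F)] are divisible by [x] and [x^n], and [Phi : A -> B] exists.  In
   the chart [U_i], put [tau = (z - r_i) / x = h_i + alpha]; then
   [w = u_i - G_i(x, tau)], so [tau] and [w] are coordinates over [K[x]].
   - Over [K(x)] this says that [z] and [w] are algebraically independent; as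
     every element of [A] is, up to a power of the nonzerodivisor [x], a
     polynomial in [x], [z] and [w], [Phi] is injective.
   - Every element of [B] is, up to a power of [x], in the image of [Phi], since
     [K[S]] becomes [K[x, 1/x, u]] when [x] is inverted.  Modulo [x],
     [A / xA] is the product of the [K[Y, W]] over the roots [r_i] and
     [y = P'(r_i) tau], so [A / xA -> B / xB] is injective.  Hence [x b = Phi a]
     forces [a] to be divisible by [x], and [Phi] is surjective. *)
Require Import Defs.
From HB Require Import structures.
From mathcomp Require Import all_boot all_order all_algebra.
From mathcomp Require Import generic_quotient ring_quotient.
From mathcomp Require Import reals complex boolp mpoly ring.

Set Implicit Arguments.
Unset Strict Implicit.
Unset Printing Implicit Defensive.

Import GRing.Theory.
Local Open Scope ring_scope.

(** * Evaluation of univariate polynomials along ring morphisms *)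

Section Evaluation.

Variables (R S : comNzRingType).

(** Commutativity of [S] discharges the side condition of [horner_morph], so [ev k m] is always a
    ring morphism. Both [eval1] and [eval2] are convertible to instances of it. *)
Definition ev (k : {rmorphism R -> S}) (m : S) : {poly R} -> S :=
  horner_morph (fun a => mulrC m (k a)).

HB.instance Definition _ k m := GRing.RMorphism.on (ev k m).

Lemma evC k m a : ev k m a%:P = k a. Proof. exact: horner_morphC. Qed.

Lemma evX k m : ev k m 'X = m. Proof. exact: horner_morphX. Qed.

Lemma poly_rmorph_ext (phi psi : {rmorphism {poly R} -> S}) :
  (forall a, phi a%:P = psi a%:P) -> phi 'X = psi 'X -> phi =1 psi.
Proof.
move=> HC HX; elim/poly_ind => [|p c IHp]; first by rewrite !rmorph0.
by rewrite !rmorphD !rmorphM /= IHp HC HX.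
Qed.

(** The universal property of [R[X]]: composites of evaluations are identified below by checking
    constants and ['X]. *)
Lemma ev_uniq (k : {rmorphism R -> S}) m (phi : {rmorphism {poly R} -> S}) :
  (forall a, phi a%:P = k a) -> phi 'X = m -> phi =1 ev k m.
Proof.
move=> HC HX; apply: (poly_rmorph_ext (psi := ev k m)) => [a|] /=.
  by rewrite evC HC.
by rewrite evX HX.
Qed.

Lemma dvd_coef (a : R) (p : {poly R}) :
  (forall k, exists c, p`_k = a * c) -> exists q, p = a%:P * q.
Proof.
elim/poly_ind: p => [|p c IHp] H; first by exists 0; rewrite mulr0.
have [k|q ->] := IHp.
  by have [d] := H k.+1; rewrite coefD coefMX coefC addr0; exists d.
have [d] := H 0%N; rewrite coefD coefMX coefC add0r /= => ->.
by exists (q * 'X + d%:P); rewrite mulrDr mulrA polyCM.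
Qed.

Lemma polyC_mulI (a : R) (p q : {poly R}) :
  (forall b c, a * b = a * c -> b = c) -> a%:P * p = a%:P * q -> p = q.
Proof.
move=> aI /polyP pq; apply/polyP => k; apply: aI.
by have := pq k; rewrite !coefCM.
Qed.

End Evaluation.

Lemma rmorph_ev (R S T : comNzRingType) (k : {rmorphism R -> S}) m
    (phi : {rmorphism S -> T}) p :
  phi (ev k m p) = ev (phi \o k : {rmorphism R -> T}) (phi m) p.
Proof.
apply: (ev_uniq (phi := phi \o ev k m : {rmorphism {poly R} -> T})) => [a|] /=.
  by rewrite evC.
by rewrite evX.
Qed.

Lemma eq_ev (R S : comNzRingType) (k k' : {rmorphism R -> S}) m :
  k =1 k' -> ev k m =1 ev k' m.
Proof.
move=> kk'; apply: (ev_uniq (phi := ev k m)) => [a|] /=; last by rewrite evX.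
by rewrite evC; apply: kk'.
Qed.

Lemma ev_comp (R S : comNzRingType) (k : {rmorphism R -> S}) m q p :
  ev k m (p \Po q) = ev k (ev k m q) p.
Proof.
pose phi : {rmorphism {poly R} -> S} := ev k m \o comp_poly q.
apply: (ev_uniq (phi := phi)) => [a|]; rewrite /phi /=.
  by rewrite comp_polyC evC.
by rewrite comp_polyX.
Qed.

(** * Membership in an image up to powers of [x] *)

Section Saturation.

Variables (R S : comNzRingType) (h : {rmorphism R -> S}) (x : R).

(** Expresses, without forming a localization, that [b] comes from [R] once [x] is inverted. *)
Definition saturated (b : S) := exists k a, h x ^+ k * b = h a.

Lemma saturated_image a : saturated (h a).
Proof. by exists 0%N, a; rewrite mul1r. Qed.

Lemma saturatedD b c : saturated b -> saturated c -> saturated (b + c).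
Proof.
move=> [k [a Ha]] [l [d Hd]]; exists (k + l)%N, (x ^+ l * a + x ^+ k * d).
rewrite rmorphD !rmorphM !rmorphXn -Ha -Hd exprD; ring.
Qed.

Lemma saturatedM b c : saturated b -> saturated c -> saturated (b * c).
Proof.
move=> [k [a Ha]] [l [d Hd]]; exists (k + l)%N, (a * d).
rewrite rmorphM -Ha -Hd exprD; ring.
Qed.

Lemma saturated_div k b : saturated (h x ^+ k * b) -> saturated b.
Proof. by move=> [l [a]]; rewrite mulrA -exprD; exists (l + k)%N, a. Qed.

End Saturation.

Lemma mpoly_ring_ind (n : nat) (R : nzRingType) (Q : {mpoly R[n]} -> Prop) :
  (forall c, Q c%:MP) -> (forall i, Q 'X_i) ->
  (forall p q, Q p -> Q q -> Q (p + q)) ->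
  (forall p q, Q p -> Q q -> Q (p * q)) -> forall p, Q p.
Proof.
move=> QC QX QD QM; elim/mpolyind => [|c m p _ _ Qp]; first by rewrite -mpolyC0.
apply: (QD) => //; rewrite -mul_mpolyC; apply: (QM) => //; rewrite mpolyXE_id.
have Q1 : Q 1 by rewrite -mpolyC1.
elim/big_rec: _ => // i q _ Qq; apply: (QM) => //.
by elim: (m i) => [|k IHk] //; rewrite exprS; apply: (QM).
Qed.

Lemma mpoly_rmorph_ext (n : nat) (R S : comNzRingType)
    (phi psi : {rmorphism {mpoly R[n]} -> S}) :
  (forall c, phi c%:MP = psi c%:MP) -> (forall i, phi 'X_i = psi 'X_i) ->
  phi =1 psi.
Proof.
move=> HC HX; elim/mpoly_ring_ind => // p q Hp Hq.
  by rewrite !rmorphD Hp Hq.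
by rewrite !rmorphM Hp Hq.
Qed.

(** * Injectivity, divisibility and saturation tested in the charts *)

Section Charts.

Variables (K : fieldType) (D : danielewski_data K).

Local Notation n := (pole D).
Local Notation sg := (sigma D).
Local Notation B := {poly coord_ring D}.

Definition chart (i : 'I_(origins D)) (f : coord_ring D) : {poly {poly K}} :=
  section_of f i.

Fact chart_zmod i : zmod_morphism (chart i).
Proof.
by move=> f g; rewrite /chart -![section_of _]/(val _) rmorphB !ffunE.
Qed.

Fact chart_monoid i : monoid_morphism (chart i).
Proof.
by split=> [|f g];
  rewrite /chart -![section_of _]/(val _) ?rmorph1 ?rmorphM !ffunE.
Qed.

HB.instance Definition _ i := GRing.isZmodMorphism.Build
  (coord_ring D) {poly {poly K}} (chart i) (chart_zmod i).
HB.instance Definition _ i := GRing.isMonoidMorphism.Build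
  (coord_ring D) {poly {poly K}} (chart i) (chart_monoid i).

Lemma chart_base i a : chart i (base D a) = a%:P.
Proof. by rewrite /chart ffunE. Qed.

Lemma chart_u i : chart i (fun_u D) = ('X^n)%:P * 'X + (sg i)%:P.
Proof. by rewrite /chart ffunE. Qed.

Lemma chart_joint_inj f g : (forall i, chart i f = chart i g) -> f = g.
Proof. by move=> fg; apply/val_inj/ffunP => i; apply: fg. Qed.

Lemma to_overlap_inj : injective (@to_overlap K).
Proof.
by apply: map_inj_poly (rmorph0 _) => a b /eqP; rewrite tofrac_eq => /eqP.
Qed.

(** The overlap is dense in every chart: the glueing relation computes component [j] from component
    [i] in [K(x)[u]], where [K[x, u]] embeds. *)
Lemma chart_inj i : injective (chart i).
Proof.
move=> f g fg; apply: chart_joint_inj => j; apply: to_overlap_inj.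
have /gluesP/(_ j i) Hf := section_glues f.
have /gluesP/(_ j i) Hg := section_glues g.
by rewrite /chart Hf Hg; congr (to_overlap _ \Po _).
Qed.

Lemma chart_xXM i k f :
  chart i (fun_x D ^+ k * f) = ('X^k)%:P * chart i f.
Proof. by rewrite rmorphM rmorphXn /= chart_base -rmorphXn. Qed.

Lemma polyXn_mulI k (b c : {poly {poly K}}) :
  ('X^k)%:P * b = ('X^k)%:P * c -> b = c.
Proof. by apply: mulfI; rewrite polyC_eq0 monic_neq0 ?monicXn. Qed.

(** Cancellation takes place in the charts, which are integral domains. *)
Lemma coord_regular k (f g : coord_ring D) :
  fun_x D ^+ k * f = fun_x D ^+ k * g -> f = g.
Proof.
move=> fg; apply: chart_joint_inj => i; apply: (@polyXn_mulI k).
by rewrite -!chart_xXM fg.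
Qed.

(** The local quotients glue: their relation times [x^k] is the relation satisfied by [f], and [x^k]
    cancels in [K(x)[u]]. *)
Lemma coord_dvd k (f : coord_ring D) :
  (forall i, exists h, chart i f = ('X^k)%:P * h) ->
  exists g, f = fun_x D ^+ k * g.
Proof.
move=> /choice[h Hh].
have hG : [ffun i => h i] \in glues (D := D).
  apply/gluesP => i j; rewrite !ffunE; have /gluesP/(_ i j) := section_glues f.
  have sE l : section_of f l = ('X^k)%:P * h l := Hh l.
  have toM a p : to_overlap (a%:P * p) = (tofrac a)%:P * to_overlap p.
    by rewrite /to_overlap rmorphM /= map_polyC.
  rewrite !sE !toM comp_polyM comp_polyC; apply: mulfI.
  by rewrite polyC_eq0 tofrac_eq0 monic_neq0 ?monicXn.
exists (CoordRing hG); apply: chart_joint_inj => i.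
by rewrite chart_xXM {2}/chart /= ffunE.
Qed.

Lemma cylinder_regular k (b c : B) :
  (fun_x D)%:P ^+ k * b = (fun_x D)%:P ^+ k * c -> b = c.
Proof. by rewrite -rmorphXn; apply: polyC_mulI; apply: coord_regular. Qed.

Lemma cylinder_dvd k (b : B) :
  (forall i, exists h, map_poly (chart i) b = ('X^k)%:P%:P * h) ->
  exists c, b = (fun_x D)%:P ^+ k * c.
Proof.
move=> H; rewrite -rmorphXn; apply: dvd_coef => m; apply: coord_dvd => i.
by have [h /polyP/(_ m)] := H i; rewrite coef_map coefCM; exists h`_m.
Qed.

(** Each coefficient in [u_i] of [chart i f - r] vanishes at [x = 0], hence is divisible by [x] by
    the factor theorem. *)
Lemma restrict_line_chart i f r : restrict_line i f = r%:P ->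
  exists h, chart i f = r%:P%:P + 'X%:P * h.
Proof.
move=> /polyP H.
have [k|h h0] := @dvd_coef _ 'X (chart i f - r%:P%:P).
  have := H k; rewrite /restrict_line (coef_map (horner_eval 0)) /=.
  rewrite horner_evalE coefB -/(chart i f) => e.
  have : root ((chart i f)`_k - r%:P%:P`_k) 0.
    by rewrite /root hornerD hornerN e !coefC; case: ifP => _;
      rewrite ?hornerC ?horner0 subrr.
  by move=> /factor_theorem[q ->]; exists q; rewrite subr0 mulrC.
by exists h; rewrite -h0 subrKC.
Qed.

(** Since [x^n u_i = u - sigma_i], the coordinate [u_i] lies in [K[x, 1/x, u]]. *)
Lemma chart_saturated i (p : {poly {poly K}}) :
  saturated (ev (polyC : {rmorphism {poly K} -> _}) (chart i (fun_u D)))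
     'X%:P p.
Proof.
set phi := (X in saturated X).
have phix : phi 'X%:P = 'X%:P by rewrite /= evC.
have satX : saturated phi 'X%:P 'X.
  apply: (@saturated_div _ _ _ _ n); rewrite phix -rmorphXn.
  have -> : ('X^n)%:P * 'X = phi ('X - (sg i)%:P) :> {poly {poly K}}.
    by rewrite rmorphB /= evX evC chart_u addrK.
  exact: saturated_image.
have satC c : saturated phi 'X%:P c%:P 
  by have := saturated_image phi 'X%:P c%:P; rewrite /= evC.
elim/poly_ind: p => [|p c IHp]; first by rewrite -polyC0.
by apply: saturatedD => //; apply: saturatedM.
Qed.

(** By injectivity of [chart i], a relation found in a single chart already holds in [K[S]]. *)
Lemma coord_saturated (f : coord_ring D) :
  saturated (ev (base D) (fun_u D)) 'X%:P f.
Proof.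
pose i : 'I_(origins D) := Ordinal (ltnW (origins_gt1 D)).
have [k [q Hq]] := chart_saturated i (chart i f).
exists k, q; apply: (@chart_inj i).
rewrite /= evC -/(fun_x D) chart_xXM rmorph_ev rmorphXn.
rewrite /= evC in Hq; rewrite /= Hq.
by apply: eq_ev => a /=; rewrite chart_base.
Qed.

End Charts.

Lemma subr_divK (F : fieldType) (a : F) (c z : {poly {poly F}}) :
  a != 0 -> c + a%:P%:P * (a^-1%:P%:P * (z - c)) = z.
Proof. by move=> a0; rewrite mulrA -!polyCM divff // mul1r addrC subrK. Qed.

(** * Chart expressions of the images of [z], [y] and [w] *)

Section Isomorphism.

Variables (K : fieldType) (D : danielewski_data K).
Variables (P : {poly K}) (lc : K) (r : 'I_(origins D) -> K).
Hypotheses (lc_neq0 : lc != 0) (r_inj : injective r).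
Hypothesis (P_prod : P = lc *: \prod_i ('X - (r i)%:P)).
Variables (f : coord_ring D) (g : {poly {poly K}}).
Variables (h G : 'I_(origins D) -> {poly {poly K}}).
Hypothesis f_chart : forall i, chart i f = (r i)%:P%:P + 'X%:P * h i.
Hypothesis g_chart : forall i,
  g \Po ((r i)%:P%:P + 'X%:P * 'X) - (sigma D i)%:P = ('X^(pole D))%:P * G i.

Local Notation n := (pole D).
Local Notation B := {poly coord_ring D}.
Local Notation C := {poly {poly {poly K}}}.
Local Notation A4 := {mpoly K[4]}.
Local Notation x := ((fun_x D)%:P : B).
Local Notation F := (f%:P + x * 'X : B).

(** The ring [C] is [K[x][u_i][alpha]], the functions on the cylinder over a chart: ['X%:P%:P] is
    [x], ['X%:P] is [u_i] and ['X] is [alpha]. *)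
Definition baseB : {rmorphism {poly K} -> B} := polyC \o base D.
Definition constB : {rmorphism K -> B} := baseB \o polyC.
Definition baseC : {rmorphism {poly K} -> C} := polyC \o polyC.
Definition constC : {rmorphism K -> C} := baseC \o polyC.
Definition chartB i : {rmorphism B -> C} := map_poly (chart i).

(* The cofactor of [Z - r_i] in [P]. *)
Definition cofP i := lc *: \prod_(j | j != i) ('X - (r j)%:P).

Lemma cofPE i : P = ('X - (r i)%:P) * cofP i.
Proof. by rewrite P_prod (bigD1 i) //= scalerAr. Qed.

Lemma cofP_neq0 i : (cofP i).[r i] != 0.
Proof.
rewrite hornerZ horner_prod mulf_neq0 //; apply/prodf_neq0 => j ji.
by rewrite hornerXsubC subr_eq0; apply: contra ji => /eqP/r_inj ->.
Qed.

Definition tau i : C := (h i)%:P + 'X.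

Lemma chartB_base i a : chartB i (baseB a) = baseC a.
Proof. by rewrite /= map_polyC /= chart_base. Qed.

Lemma chartB_F i : chartB i F = baseC (r i)%:P + baseC 'X * tau i.
Proof.
rewrite rmorphD rmorphM (chartB_base i 'X) /= map_polyX map_polyC /= f_chart.
by rewrite /tau rmorphD rmorphM /=; ring.
Qed.

(** The factor [Z - r_i] of [P] takes the value [x tau_i] at [F]. *)
Lemma chartB_PF i :
  chartB i (eval1 P F) = baseC 'X * (tau i * ev constC (chartB i F) (cofP i)).
Proof.
rewrite -[eval1 P F]/(ev constB F P) rmorph_ev (@eq_ev _ _ _ constC) => [|c].
  rewrite [in LHS](cofPE i) rmorphM rmorphB /= evX evC mulrA; congr (_ * _).
  by rewrite -[X in _ - X]/(baseC (r i)%:P) chartB_F addrC addKr.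
exact: (chartB_base i c%:P).
Qed.

(** Both [u = x^n u_i + sigma_i] and [g(x, F) = sigma_i + x^n G_i(x, tau_i)] hold in the chart, and
    [sigma_i] cancels. *)
Lemma chartB_u_g i : chartB i ((fun_u D)%:P - eval2 g F) =
  baseC 'X ^+ n * ('X%:P - ev baseC (tau i) (G i)).
Proof.
rewrite rmorphB -[eval2 g F]/(ev baseB F g) rmorph_ev chartB_F.
rewrite (@eq_ev _ _ _ baseC) => [|a]; last exact: chartB_base.
(* The congruence on [g] is specialized at [t = tau_i]. *)
have := congr1 (ev baseC (tau i)) (g_chart i).
rewrite rmorphB rmorphM /= !evC /= => Hg.
rewrite mulrBr -(rmorphXn baseC) /=.
rewrite -[X in _ = _ - X]Hg ev_comp rmorphD rmorphM /= !evC evX.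
by rewrite map_polyC /= chart_u !rmorphD !rmorphM /=; ring.
Qed.

Lemma x_dvd_PF : exists y, x * y = eval1 P F.
Proof.
have [i|y ->] := @cylinder_dvd _ D 1 (eval1 P F); last by exists y.
by rewrite -/(chartB i _) chartB_PF; eexists; rewrite expr1.
Qed.

Lemma x_dvd_u_g : exists w, x ^+ n * w = (fun_u D)%:P - eval2 g F.
Proof.
have [i|w ->] := @cylinder_dvd _ D n ((fun_u D)%:P - eval2 g F);
  last by exists w.
by rewrite -/(chartB i _) chartB_u_g -(rmorphXn baseC); eexists.
Qed.

Variables (yB wB : B).
Hypotheses (yBE : x * yB = eval1 P F).
Hypotheses (wBE : x ^+ n * wB = (fun_u D)%:P - eval2 g F).

Lemma baseC_X_neq0 : baseC 'X != 0.
Proof. by rewrite /= !polyC_eq0 polyX_eq0. Qed.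

Lemma chartB_y i : chartB i yB = tau i * ev constC (chartB i F) (cofP i).
Proof.
apply: (mulfI baseC_X_neq0); rewrite -chartB_PF -yBE rmorphM.
by rewrite (chartB_base i 'X).
Qed.

Lemma chartB_w i : chartB i wB = 'X%:P - ev baseC (tau i) (G i).
Proof.
apply: (mulfI (expf_neq0 n baseC_X_neq0)); rewrite -chartB_u_g -wBE rmorphM.
by rewrite rmorphXn (chartB_base i 'X).
Qed.

(* In the chart [U_i], the functions [(z - r_i) / x] and [w] are triangular in
   [alpha] and [u_i], so their values over [K[x]] may be prescribed. *)
Lemma coordinates_extend (M : comNzRingType) (k : {rmorphism {poly K} -> M}) i
    (t w : M) (z := k (r i)%:P + k 'X * t) :
  exists theta : {rmorphism B -> M},
    [/\ forall a, theta (baseB a) = k a, theta F = z,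
        theta yB = t * ev (k \o polyC : {rmorphism K -> M}) z (cofP i) &
        theta wB = w].
Proof.
(* The equations [w = u_i - G_i(x, tau)] and [tau = h_i + alpha] are solved for [u_i] and then for
   [alpha], in this order because [h_i] involves [u_i]. *)
pose u := w + ev k t (G i).
pose phi : {rmorphism {poly {poly K}} -> M} := ev k u.
pose theta : {rmorphism C -> M} := ev phi (t - phi (h i)).
have th_base a : theta (baseC a) = k a by rewrite /= evC /phi /= evC.
have th_tau : theta (tau i) = t by rewrite /tau rmorphD /= evC evX addrC subrK.
have th_F : theta (chartB i F) = z.
  by rewrite chartB_F rmorphD rmorphM !th_base th_tau.
exists (theta \o chartB i); split=> [a|||].
- by rewrite [LHS]/= -/(chartB i _) chartB_base th_base.
- by rewrite [LHS]/= -/(chartB i _) th_F.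
- rewrite [LHS]/= -/(chartB i _) chartB_y rmorphM th_tau rmorph_ev th_F.
  by congr (_ * _); apply: eq_ev => c; rewrite /= !evC /phi /= evC.
- rewrite [LHS]/= -/(chartB i _) chartB_w rmorphB rmorph_ev th_tau.
  rewrite (@eq_ev _ _ _ k) => [|a]; last exact: th_base.
  by rewrite /= evC /phi /= evX addrK.
Qed.

(** * The morphism [Phi] on the quotient ring *)

Definition sub_gens : A4 -> B :=
  mmap constB (fun i => nth 0 [:: x; yB; F; wB] i).
HB.instance Definition _ := GRing.RMorphism.on sub_gens.

Lemma sub_gensC c : sub_gens c%:MP = constB c. Proof. exact: mmapC. Qed.

Lemma sub_gensX i : sub_gens 'X_i = nth 0 [:: x; yB; F; wB] i.
Proof. by rewrite /sub_gens mmapX mmap1U. Qed.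

Lemma evalW : (map_poly (@mpolyC 4 K) P).[varZ K] =
  ev (@mpolyC 4 K) (varZ K) P.
Proof. by []. Qed.

Lemma sub_gens_eqnW : sub_gens (eqnW P) = 0.
Proof.
rewrite /eqnW rmorphB rmorphM /= !sub_gensX /= yBE evalW.
rewrite rmorph_ev /= sub_gensX /=.
rewrite -[eval1 P F]/(ev constB F P); apply/eqP; rewrite subr_eq0; apply/eqP.
apply: eq_ev => c.
by rewrite /= sub_gensC.
Qed.

Definition Phi (a : coordW P) : B := sub_gens (repr a).

Lemma classWP p q : reflect (exists s, p - q = s * eqnW P)
  (classW P p == classW P q).
Proof. by rewrite -Quotient.idealrBE; apply: asboolP. Qed.

(** Two representatives differ by a multiple of [eqnW P], which [sub_gens] kills. *)
Lemma Phi_class p : Phi (classW P p) = sub_gens p.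
Proof.
have /classWP[s Hs] : classW P (repr (classW P p)) == classW P p.
  by rewrite /classW reprK.
by apply/eqP; rewrite -subr_eq0 -rmorphB Hs rmorphM /= sub_gens_eqnW mulr0.
Qed.

Lemma classW_ind (Q : coordW P -> Prop) :
  (forall p, Q (classW P p)) -> forall a, Q a.
Proof. by move=> H a; rewrite -[a]reprK; apply: H. Qed.

Definition classWM : {rmorphism A4 -> coordW P} := classW P.

Fact Phi_zmod : zmod_morphism Phi.
Proof.
elim/classW_ind => p; elim/classW_ind => q.
by rewrite -(rmorphB classWM) /= !Phi_class rmorphB.
Qed.

Fact Phi_monoid : monoid_morphism Phi.
Proof.
split; first by rewrite -(rmorph1 classWM) /= Phi_class rmorph1.
elim/classW_ind => p; elim/classW_ind => q.
by rewrite -(rmorphM classWM) /= !Phi_class rmorphM.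
Qed.

HB.instance Definition _ :=
  GRing.isZmodMorphism.Build (coordW P) B Phi Phi_zmod.
HB.instance Definition _ :=
  GRing.isMonoidMorphism.Build (coordW P) B Phi Phi_monoid.

Local Notation cX := (classW P (varX K)).
Local Notation cY := (classW P (varY K)).
Local Notation cZ := (classW P (varZ K)).
Local Notation cW := (classW P (varW K)).

Lemma Phi_const c : Phi (cstW P c) = constB c.
Proof. by rewrite /cstW Phi_class sub_gensC. Qed.

Lemma Phi_X : Phi cX = x. Proof. by rewrite Phi_class sub_gensX. Qed.
Lemma Phi_Y : Phi cY = yB. Proof. by rewrite Phi_class sub_gensX. Qed.
Lemma Phi_Z : Phi cZ = F. Proof. by rewrite Phi_class sub_gensX. Qed.
Lemma Phi_W : Phi cW = wB. Proof. by rewrite Phi_class sub_gensX. Qed.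

(** * Regularity of [x] in [coordW P] and reduction modulo [x] *)

Definition constM : {rmorphism K -> {poly {poly K}}} := polyC \o polyC.

Definition constT : {rmorphism K -> {poly {poly {poly {poly K}}}}} :=
  polyC \o polyC \o constM.

(* [K[X, Y, Z, W]] seen as [K[W][Y][Z][X]]. *)
Definition nest : A4 -> {poly {poly {poly {poly K}}}} :=
  mmap constT
    (fun i => nth 0 [:: 'X; 'X%:P%:P; 'X%:P; 'X%:P%:P%:P] i).
HB.instance Definition _ := GRing.RMorphism.on nest.

Lemma nestC c : nest c%:MP = constT c. Proof. exact: mmapC. Qed.

Lemma nestX i :
  nest 'X_i = nth 0 [:: 'X; 'X%:P%:P; 'X%:P; 'X%:P%:P%:P] i.
Proof. by rewrite /nest mmapX mmap1U. Qed.

Definition flat : {poly {poly {poly {poly K}}}} -> A4 :=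
  ev (ev (ev (ev (@mpolyC 4 K) (varW K)) (varY K)) (varZ K)) (varX K).
HB.instance Definition _ := GRing.RMorphism.on flat.

(** Brings back to [A4] the factorizations obtained in the nested ring, where the factor theorem
    applies to [X] and to [Z]. *)
Lemma nestK p : flat (nest p) = p.
Proof.
apply: (mpoly_rmorph_ext (phi := flat \o nest) (psi := idfun)) => [c|i].
  by rewrite /= nestC /flat; do 4!rewrite /= evC.
rewrite /= nestX; case: i => [[|[|[|[|//]]]] lt_i] /=;
  rewrite /flat; do 4!rewrite /= ?evC ?evX;
  by congr 'X_ _; apply: val_inj.
Qed.

Lemma nest_eqnW : nest (eqnW P) = 'X * 'X%:P%:P - (map_poly constM P)%:P.
Proof.
rewrite /eqnW rmorphB rmorphM /= !nestX /= evalW rmorph_ev; congr (_ - _).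
apply/esym; apply: (ev_uniq (phi := polyC \o map_poly constM)) => [c|] /=.
  by rewrite map_polyC /= nestC.
by rewrite map_polyX nestX.
Qed.

Lemma P_neq0 : P != 0.
Proof.
by rewrite P_prod scaler_eq0 negb_or lc_neq0 monic_neq0 ?monic_prod_XsubC.
Qed.

(** If [X p = q (XY - P(Z))], setting [X = 0] gives [q(0) P(Z) = 0], so [q = X s]; cancelling [X]
    leaves [p = s (XY - P(Z))]. *)
Lemma coordW_regular a : cX * a = 0 -> a = 0.
Proof.
elim/classW_ind: a => p; rewrite -(rmorphM classWM) -(rmorph0 classWM) /=.
move=> /eqP/classWP[q]; rewrite subr0 => /(congr1 nest).
rewrite !rmorphM /= nestX /= nest_eqnW => pq.
have : (nest q).[0] = 0.
  have := congr1 (fun s : {poly {poly {poly {poly K}}}} => s.[0]) pq.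
  rewrite hornerM hornerX mul0r hornerM hornerD hornerN hornerM hornerX mul0r.
  rewrite hornerC sub0r => /esym/eqP; rewrite mulrN oppr_eq0 mulf_eq0.
  by rewrite map_poly_eq0 (negPf P_neq0) orbF => /eqP.
move=> /rootP/factor_theorem[s Hs].
apply/eqP/classWP; exists (flat s); rewrite subr0 -[LHS]nestK -[eqnW P]nestK.
rewrite -rmorphM nest_eqnW; congr (flat _).
apply: (@mulfI _ 'X); first by rewrite polyX_eq0.
by rewrite pq Hs subr0 -mulrA mulrCA.
Qed.

(** At [X = 0] the polynomial vanishes at every root [Z = r_i], hence is a multiple of [P(Z)], which
    lies in the ideal generated by [X] and [eqnW P]. *)
Lemma coordW_dvd p : (forall i, (nest p).[0].[constM (r i)] = 0) ->
  exists a, classW P p = cX * a.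
Proof.
move=> H.
have [s Hs] : exists s, (nest p).[0] = s * map_poly constM P.
  (* Over [K[W][Y]], removing all the linear factors requires invertible differences of roots; they
     are images of nonzero elements of [K]. *)
  have [||s ->] := @uniq_roots_prod_XsubC _ (nest p).[0]
    [seq constM (r i) | i : 'I_(origins D)].
  - by apply/allP => _ /mapP[i _ ->]; apply/eqP.
  - by rewrite /image_mem map_comp map_uniq_roots map_inj_uniq ?enum_uniq.
  exists (constM lc^-1 *: s).
  rewrite P_prod map_polyZ rmorph_prod -scalerAr -scalerAl scalerA -rmorphM.
  rewrite mulfV //= rmorph1 scale1r big_image /=; congr (_ * _).
  by apply: eq_bigr => i _; rewrite map_polyXsubC.
have [q Hq] : exists q, nest p - ((nest p).[0])%:P = q * ('X - 0%:P).
  by apply/factor_theorem/rootP; rewrite !hornerE subrr.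
(* From [p = q X + s P(Z)] and [P(Z) = XY - eqnW], one gets [p = X (q + s Y) - s eqnW]. *)
exists (classW P (flat (q + s%:P * 'X%:P%:P))).
rewrite -(rmorphM classWM) /=; apply/eqP/classWP; exists (flat (- s%:P)).
rewrite -[X in X - _]nestK -[varX K]nestK -[eqnW P]nestK -!rmorphM -rmorphB.
congr (flat _).
rewrite -[nest p](subrK ((nest p).[0])%:P) Hq Hs nest_eqnW nestX /=.
by rewrite rmorphM subr0 /=; ring.
Qed.

(** For each [i], some morphism [th] on [B] kills [x] and satisfies that [th] after [sub_gens] is
    evaluation at [X = 0], [Z = r_i]. It kills [x * b], so [coordW_dvd] applies. *)
Lemma Phi_dvd a b : Phi a = x * b -> exists a', a = cX * a'.
Proof.
elim/classW_ind: a => p; rewrite Phi_class => Hp; apply: coordW_dvd => i.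
pose M := {poly {poly K}}.
pose k : {rmorphism {poly K} -> M} := constM \o horner_eval 0.
(* Here [M] is [K[W][Y]]. At [x = 0] the image of [y] is [tau] times the cofactor at [r_i], so
   dividing [Y] by that nonzero constant makes [y] go to [Y]. *)
have [th [thk thF thy thw]] :=
  coordinates_extend k i (constM (cofP i).[r i]^-1 * 'X) 'X%:P.
have kC c : k c%:P = constM c by rewrite /k /= horner_evalE hornerC.
have kX : k 'X = 0 by rewrite /k /= horner_evalE hornerX.
have thX : th x = 0 by rewrite -kX -thk.
pose rho : {rmorphism A4 -> M} :=
  horner_eval (constM (r i)) \o (horner_eval 0 \o nest).
have <- : th (sub_gens p) = (nest p).[0].[constM (r i)].
  rewrite -[RHS]/(rho p).
  apply: (mpoly_rmorph_ext (phi := th \o sub_gens)) => [c|[j lt_j]].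
    rewrite /rho [LHS]/= sub_gensC thk kC.
    by rewrite [RHS]/= nestC /= !horner_evalE !hornerC.
  rewrite /rho [LHS]/= [RHS]/= sub_gensX nestX.
  case: j lt_j => [|[|[|[|//]]]] lt_j /=; rewrite !horner_evalE.
  - by rewrite hornerX horner0.
  - rewrite thy kX mul0r addr0 kC hornerC hornerC.
    rewrite (@eq_ev _ _ _ constM) => [|c]; last exact: kC.
    rewrite -[ev _ _ _]/(map_poly constM _).[_] horner_map mulrAC -rmorphM.
    by rewrite mulVf ?cofP_neq0 // rmorph1 mul1r.
  - by rewrite thF kX mul0r addr0 kC hornerC hornerX.
  - by rewrite thw hornerC hornerC.
by rewrite Hp rmorphM thX mul0r.
Qed.

(** * Surjectivity of [Phi] *)

Definition baseW : {rmorphism {poly K} -> coordW P} :=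
  ev (classWM \o @mpolyC 4 K) cX.

Lemma Phi_baseW a : Phi (baseW a) = baseB a.
Proof.
rewrite rmorph_ev /= Phi_X; apply/esym.
apply: (ev_uniq (phi := baseB)) => [c|] //=.
exact: (esym (Phi_const c)).
Qed.

Lemma baseWX : baseW 'X = cX. Proof. by rewrite /= evX. Qed.

(** The image contains [u = x^n w + g(x, z)], so [coord_saturated] reaches [K[S]] up to powers of
    [x]; then [x alpha = z - f] reaches [alpha]. *)
Lemma Phi_saturated b : saturated Phi cX b.
Proof.
have uE : (fun_u D)%:P = Phi (cX ^+ n * cW + ev baseW cZ g).
  rewrite rmorphD rmorphM rmorphXn rmorph_ev /= Phi_X Phi_W Phi_Z wBE.
  rewrite (@eq_ev _ _ _ baseB) => [|a]; last exact: Phi_baseW.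
  by rewrite subrK.
have satC (q : coord_ring D) : saturated Phi cX q%:P.
  have [k [s]] := coord_saturated q; rewrite /= evC => Hs.
  apply: (@saturated_div _ _ _ _ k); rewrite /= Phi_X -rmorphXn -rmorphM /= Hs.
  have -> : (ev (base D) (fun_u D) s)%:P
      = Phi (ev baseW (cX ^+ n * cW + ev baseW cZ g) s).
    rewrite (rmorph_ev _ _ (polyC : {rmorphism coord_ring D -> B})).
    rewrite (rmorph_ev _ _ (Phi : {rmorphism coordW P -> B})) [RHS]/= -uE.
    by apply: eq_ev => a; apply: esym; apply: Phi_baseW.
  exact: saturated_image.
elim/poly_ind: b => [|b c IHb]; first by rewrite -polyC0.
apply: saturatedD => //; apply: saturatedM => //.
apply: (@saturated_div _ _ _ _ 1); rewrite expr1 /= Phi_X.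
have -> : x * 'X = Phi cZ + (- f)%:P by rewrite Phi_Z polyCN addrC addKr.
by apply: saturatedD => //; apply: saturated_image.
Qed.

Lemma Phi_surjective b : exists a, Phi a = b.
Proof.
have [k [a]] := Phi_saturated b; rewrite /= Phi_X.
(* The powers of [x] are removed one at a time, dividing the preimage by [Phi_dvd] and cancelling
   [x] in [B]. *)
elim: k a => [|k IHk] a; first by rewrite mul1r; exists a.
rewrite exprS -mulrA => /esym Ha; have [a' aE] := Phi_dvd Ha.
apply: (IHk a'); apply: (@cylinder_regular _ D 1).
by rewrite !expr1 -Ha aE rmorphM /= Phi_X.
Qed.

(** * Injectivity of [Phi] *)

(* The inclusion of [K[x, z, w]], nested as [K[X][Z][W]]. *)
Definition incl : {poly {poly {poly K}}} -> coordW P := ev (ev baseW cZ) cW.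
HB.instance Definition _ := GRing.RMorphism.on incl.

Lemma incl_base a : incl a%:P%:P = baseW a.
Proof. by rewrite /incl evC /= evC. Qed.

Lemma incl_Z : incl 'X%:P = cZ. Proof. by rewrite /incl evC /= evX. Qed.

Lemma incl_W : incl 'X = cW. Proof. by rewrite /incl evX. Qed.

Lemma incl_X : incl 'X%:P%:P = cX. Proof. by rewrite incl_base baseWX. Qed.

Lemma coordW_rel : cX * cY = incl (map_poly polyC P)%:P.
Proof.
have -> : cX * cY = classWM (ev (@mpolyC 4 K) (varZ K) P).
  by rewrite -(rmorphM classWM); apply/eqP/classWP; exists 1; rewrite mul1r.
rewrite rmorph_ev /incl evC; apply/esym.
apply: (ev_uniq (phi := ev baseW cZ \o map_poly polyC)) => [c|] /=.
  by rewrite map_polyC evC /= evC.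
by rewrite map_polyX evX.
Qed.

Lemma incl_saturated a : saturated incl 'X%:P%:P a.
Proof.
elim/classW_ind: a => p.
elim/mpoly_ring_ind: p => [c|[j lt_j]|p q Hp Hq|p q Hp Hq].
- have -> : classW P c%:MP = incl c%:P%:P%:P by rewrite incl_base /= evC.
  exact: saturated_image.
- case: j lt_j => [|[|[|[|//]]]] lt_j; rewrite (bool_irrelevance lt_j isT).
  + by rewrite -/(varX K) -incl_X; apply: saturated_image.
  (* Only [y] requires a power of [x]: the product [x y = P(z)] is in the image of [incl]. *)
  + apply: (@saturated_div _ _ _ _ 1).
    rewrite expr1 /= incl_X -/(varY K) coordW_rel; exact: saturated_image.
  + by rewrite -/(varZ K) -incl_Z; apply: saturated_image.
  + by rewrite -/(varW K) -incl_W; apply: saturated_image.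
- rewrite [classW P _](rmorphD classWM p q) /=; exact: saturatedD.
- rewrite [classW P _](rmorphM classWM p q) /=; exact: saturatedM.
Qed.

(** Followed by a suitable morphism from [B] to [K(x)[Z][W]], the map [Phi \o incl] becomes the
    coefficientwise inclusion of [K[x][Z][W]], which is injective. *)
Lemma Phi_incl_eq0 q : Phi (incl q) = 0 -> q = 0.
Proof.
pose i : 'I_(origins D) := Ordinal (ltnW (origins_gt1 D)).
pose Q := {fraction {poly K}}; pose M := {poly {poly Q}}.
pose k : {rmorphism {poly K} -> M} := polyC \o polyC \o @tofrac {poly K}.
(* This value of [tau] gives [r_i + x tau = Z], so that [F] is sent to [Z]. *)
pose t : M := (tofrac 'X)^-1%:P%:P * ('X%:P - k (r i)%:P).
have [th [thk thF _ thw]] := coordinates_extend k i t 'X.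
have {}thF : th F = 'X%:P.
  by rewrite thF; apply: subr_divK; rewrite tofrac_eq0 polyX_eq0.
pose psi : {rmorphism {poly {poly {poly K}}} -> M} :=
  map_poly (map_poly (@tofrac {poly K})).
have thE : th \o (Phi \o incl) =1 psi.
  apply: (poly_rmorph_ext (phi := th \o (Phi \o incl))) => [p|]; last first.
    by rewrite /= incl_W Phi_W thw map_polyX.
  apply: (poly_rmorph_ext (phi := th \o (Phi \o incl) \o polyC)
                          (psi := psi \o polyC)) => [a|].
    by rewrite [LHS]/= incl_base Phi_baseW thk /psi /=;
      do 2!rewrite map_polyC /=.
  by rewrite [LHS]/= incl_Z Phi_Z thF /psi /= map_polyC /= map_polyX.
move=> /(congr1 th); rewrite -[th _]/((th \o (Phi \o incl)) q) thE rmorph0.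
have frac_inj : injective (@tofrac {poly K}).
  by move=> a b /eqP; rewrite tofrac_eq => /eqP.
move=> /= q0.
apply: (map_inj_poly (map_inj_poly frac_inj (rmorph0 _)) (rmorph0 _)).
by rewrite q0 rmorph0.
Qed.

(** A kernel element times some [x^k] equals [incl q]; then [q = 0], and [x^k] cancels in
    [coordW P]. *)
Lemma Phi_injective : injective Phi.
Proof.
move=> a b /eqP; rewrite -subr_eq0 -rmorphB => /eqP ab.
apply/eqP; rewrite -subr_eq0; apply/eqP; move: (a - b) ab => {a b} a Phia.
have [k [q Hq]] := incl_saturated a.
have : incl 'X%:P%:P ^+ k * a = 0.
  by rewrite Hq (@Phi_incl_eq0 q) ?rmorph0 // -Hq rmorphM Phia mulr0.
rewrite incl_X; elim: k {Hq} => [|k IHk]; first by rewrite mul1r.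
by rewrite exprS -mulrA => /coordW_regular.
Qed.

Lemma Phi_bijective : bijective Phi.
Proof.
have [psi psiK] := choice Phi_surjective.
by exists psi => // a; apply: Phi_injective; rewrite psiK.
Qed.

Lemma cylinder_isomorphism : exists phi : {rmorphism coordW P -> B},
  [/\ forall c, phi (cstW P c) = cstS D c, phi cX = x, phi cZ = F,
      phi cY = yB & phi cW = wB] /\ bijective phi.
Proof.
exists Phi; split; last exact: Phi_bijective.
split; [exact: Phi_const | exact: Phi_X | exact: Phi_Z | exact: Phi_Y |].
exact: Phi_W.
Qed.

End Isomorphism.

(** * Factorization of [P], and the isomorphism *)

(** Simplicity makes the list [s] of roots duplicate-free, and the degree gives it length [m]. As
    [s] is contained in the [m] values of [r], these are pairwise distinct and are a permutation of
    [s]. *)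
Lemma simple_roots_factor (K : closedFieldType) m (P : {poly K})
    (r : 'I_m -> K) :
  size P = m.+1 -> (forall a, root P a <-> exists i, a = r i) ->
  (forall i, mup (r i) P = 1%N) ->
  injective r /\ P = lead_coef P *: \prod_i ('X - (r i)%:P).
Proof.
move=> szP rootsP simpleP.
have P0 : P != 0 by rewrite -size_poly_eq0 szP.
have [s Ps] := closed_field_poly_normal P.
have lP0 : lead_coef P != 0 by rewrite lead_coef_eq0.
have sz_s : size s = m.
  by apply: succn_inj; rewrite -szP Ps size_scale // size_prod_XsubC.
have mem_s a : a \in s = root P a by rewrite Ps rootZ // root_prod_XsubC.
have uniq_s : uniq s.
  apply: count_mem_uniq => z; case: (boolP (z \in s)) => [zs|]; last first.
    by move/count_memPn.
  have [i zi] : exists i, z = r i by apply/rootsP; rewrite -mem_s.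
  have perm_z := perm_to_rem zs; rewrite (permP perm_z) /= eqxx.
  suff : z \notin rem z s by move/count_memPn => ->.
  apply/negP => /perm_to_rem zzs.
  have : (1 < mup z P)%N; last by rewrite zi simpleP.
  rewrite mup_geq // Ps (perm_big _ perm_z) big_cons (perm_big _ zzs) big_cons.
  by rewrite /= dvdpZr // mulrA -expr2 dvdp_mulr.
have sub_s : {subset s <= codom r}.
  by move=> a; rewrite mem_s => /rootsP[i ->]; apply: codom_f.
have sz_le : (size (codom r) <= size s)%N by rewrite size_codom card_ord sz_s.
have uniq_r : uniq (codom r) := leq_size_uniq uniq_s sub_s sz_le.
split; first exact/injectiveP.
rewrite {1}Ps; congr (_ *: _).
transitivity (\prod_(z <- codom r) ('X - z%:P)); last by rewrite big_image.
apply: perm_big; apply: uniq_perm => //.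
by have [_ ] := uniq_min_size uniq_s sub_s sz_le.
Qed.

Theorem theorem4p0p1 (R : realType) (D : danielewski_data R[i])
    (P : {poly R[i]}) (r : 'I_(origins D) -> R[i])
    (P_degree : size P = (origins D).+1)
    (P_roots : forall a : R[i], root P a <-> exists i, a = r i)
    (P_simple : forall i, mup (r i) P = 1%N)
    (f : coord_ring D)
    (f_restrict : forall i, restrict_line i f = (r i)%:P)
    (g : {poly {poly R[i]}})
    (g_mod : forall i, exists h : {poly {poly R[i]}},
       g \Po ((r i)%:P%:P + 'X%:P * 'X) - (sigma D i)%:P
       = ('X^(pole D))%:P * h) :
  let x : {poly coord_ring D} := (fun_x D)%:P in
  let u : {poly coord_ring D} := (fun_u D)%:P in
  let alpha : {poly coord_ring D} := 'X in
  let F : {poly coord_ring D} := f%:P + x * alpha in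
  exists Phi : {rmorphism coordW P -> {poly coord_ring D}},
    [/\ forall c : R[i], Phi (cstW P c) = cstS D c,
        Phi (classW P (varX R[i])) = x,
        Phi (classW P (varZ R[i])) = F,
        is_quotient (eval1 P F) x (Phi (classW P (varY R[i]))) &
        is_quotient (u - eval2 g F) (x ^+ pole D)
                    (Phi (classW P (varW R[i])))]
    /\ bijective Phi.
have [r_inj P_prod] := simple_roots_factor P_degree P_roots P_simple.
have lc_neq0 : lead_coef P != 0.
  by rewrite lead_coef_eq0 -size_poly_eq0 P_degree.
have /choice[h f_chart] : forall i, exists h,
    chart i f = (r i)%:P%:P + 'X%:P * h.
  by move=> i; apply: restrict_line_chart.
have /choice[G g_chart] := g_mod.
move=> x u alpha F.
have [y yE] := x_dvd_PF P_prod f_chart.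
have [w wE] := x_dvd_u_g f_chart g_chart.
have [phi [[phiC phiX phiZ phiY phiW] phi_bij]] :=
  cylinder_isomorphism lc_neq0 r_inj P_prod f_chart g_chart yE wE.
(* Uniqueness of both quotients is the cancellation of powers of [x] in [K[S][alpha]]. *)
exists phi; split=> //; rewrite phiY phiW; split=> // q; split=> [xq|-> //].
  by apply: (@cylinder_regular _ D 1); rewrite !expr1 yE.
by apply: (@cylinder_regular _ D (pole D)); rewrite wE.
Qed.
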